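(* Let $p\in(0,1)$ and $y_-<y_+<x_-<x_+<z_-<z_+$ be such that $$x_+-y_-\ge z_--x_-,\qquad z_+-x_-\ge x_+-y_+,$$ $$(x_--y_-)\wedge(x_+-y_+)\wedge(z_--x_-)\wedge(z_+-x_+)\ge(x_--y_+)\vee(z_--x_+).$$ Set $\mu=p\,\delta_{x_-}+(1-p)\,\delta_{x_+}$, $$\underline\nu=p\frac{z_--x_-}{z_--y_-}\delta_{y_-}+p\frac{x_--y_-}{z_--y_-}\delta_{z_-}+(1-p)\frac{z_+-x_+}{z_+-y_+}\delta_{y_+}+(1-p)\frac{x_+-y_+}{z_+-y_+}\delta_{z_+},$$ $$\pi^\uparrow=p\left(\frac{z_--x_-}{z_--y_-}\delta_{(x_-,y_-)}+\frac{x_--y_-}{z_--y_-}\delta_{(x_-,z_-)}\right)+(1-p)\left(\frac{z_+-x_+}{z_+-y_+}\delta_{(x_+,y_+)}+\frac{x_+-y_+}{z_+-y_+}\delta_{(x_+,z_+)}\right),$$ $$\overline\nu=p\frac{z_+-x_-}{z_+-y_+}\delta_{y_+}+p\frac{x_--y_+}{z_+-y_+}\delta_{z_+}+(1-p)\frac{z_--x_+}{z_--y_-}\delta_{y_-}+(1-p)\frac{x_+-y_-}{z_--y_-}\delta_{z_-},$$ $$\pi^\downarrow=p\left(\frac{z_+-x_-}{z_+-y_+}\delta_{(x_-,y_+)}+\frac{x_--y_+}{z_+-y_+}\delta_{(x_-,z_+)}\right)+(1-p)\left(\frac{z_--x_+}{z_--y_-}\delta_{(x_+,y_-)}+\frac{x_+-y_-}{z_--y_-}\delta_{(x_+,z_-)}\right).$$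 Then $\pi^\uparrow\in\Pi_M(\mu,\underline\nu)$ and $\mathrm{sq}\#\pi^\uparrow=\inf_{cx}\{\mathrm{sq}\#\pi:\pi\in\Pi_M(\mu,\underline\nu)\}$; and $\pi^\downarrow\in\Pi_M(\mu,\overline\nu)$ and $\mathrm{sq}\#\pi^\downarrow=\sup_{cx}\{\mathrm{sq}\#\pi:\pi\in\Pi_M(\mu,\overline\nu)\}$.
   Context: $\Pi(\mu,\nu)$ is the set of probability measures on $\mathbb R\times\mathbb R$ with first marginal $\mu$ and second marginal $\nu$; $\Pi_M(\mu,\nu)$ is the set of martingale couplings, i.e. of $\pi(dx,dy)=\mu(dx)\pi_x(dy)\in\Pi(\mu,\nu)$ such that $\int_{\mathbb R} y\,\pi_x(dy)=x$ for $\mu(dx)$-almost every $x$. $\mathrm{sq}(x,y)=(y-x)^2$ and $\mathrm{sq}\#\pi$ is the image (push-forward) of $\pi$ by $\mathrm{sq}$. The convex order $\eta\le_{cx}\theta$ between probability measures on $\mathbb R$ with finite first moment means $\int\varphi\,d\eta\le\int\varphi\,d\theta$ for every convex $\varphi:\mathbb R\to\mathbb R$; $\inf_{cx}$ and $\sup_{cx}$ denote the infimum (greatest lower bound) and supremum (least upper bound) for this order. $\wedge$ and $\vee$ denote minimum and maximum. *)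

(* Defs.v *)
From HB Require Import structures.
From mathcomp Require Import all_boot all_order all_algebra.
From mathcomp Require Import all_classical all_reals all_analysis.
From mathcomp Require Import measurable_realfun.

Set Implicit Arguments.
Unset Strict Implicit.
Unset Printing Implicit Defensive.

Import Order.TTheory GRing.Theory Num.Theory.
Import numFieldNormedType.Exports.

Local Open Scope classical_set_scope.
Local Open Scope ring_scope.

Section dirac_mix.
Context d (T : measurableType d) (R : realType).
Implicit Type s : seq (R * T).

Definition is_weighting s : bool :=
  all (fun wa => 0 <= wa.1) s && (\sum_(wa <- s) wa.1 == 1).

(* [:: (w1, a1); ...; (wn, an)] encodes w1 delta_a1 + ... + wn delta_an. As in
   bernoulli_prob, weights that are not a probability vector give a default
   Dirac mass, so that the result is always a probability measure. *)
Definition dirac_mix_fun s (A : set T) : \bar R :=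
  if is_weighting s then (\sum_(wa <- s) wa.1%:E * \d_wa.2 A)%E
  else \d_point A.

Lemma dirac_mix_measureP s : all (fun wa => 0 <= wa.1) s ->
  exists m : {measure set T -> \bar R},
    (fun A => \sum_(wa <- s) wa.1%:E * \d_wa.2 A)%E = m.
Proof.
elim: s => [_|[w a] s IH /= /andP[w0 /IH[m mE]]].
  by exists mzero; apply/funext => A; rewrite big_nil.
exists (measure_add (mscale (NngNum w0) \d_a) m).
by apply/funext => A; rewrite big_cons [RHS]measure_addE -mE.
Qed.

Let dirac_mix_measure s :
  exists m : {measure set T -> \bar R}, dirac_mix_fun s = m.
Proof.
case: (boolP (is_weighting s)) => sW; last first.
  by exists \d_point; apply/funext => A; rewrite /dirac_mix_fun (negbTE sW).
have /andP[/dirac_mix_measureP[m mE] _] := sW.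
by exists m; rewrite -mE; apply/funext => A; rewrite /dirac_mix_fun sW.
Qed.

Let dirac_mix0 s : dirac_mix_fun s set0 = 0%E.
Proof. by have [m ->] := dirac_mix_measure s. Qed.

Let dirac_mix_ge0 s A : (0 <= dirac_mix_fun s A)%E.
Proof. by have [m ->] := dirac_mix_measure s. Qed.

Let dirac_mix_sigma_additive s : semi_sigma_additive (dirac_mix_fun s).
Proof.
by have [m ->] := dirac_mix_measure s; exact: measure_semi_sigma_additive.
Qed.

HB.instance Definition _ s := isMeasure.Build _ _ _ (dirac_mix_fun s)
  (dirac_mix0 s) (dirac_mix_ge0 s) (@dirac_mix_sigma_additive s).

Let dirac_mixT s : dirac_mix_fun s [set: T] = 1%E.
Proof.
rewrite /dirac_mix_fun; case: ifPn => [/andP[_ /eqP s1]|_]; last first.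
  by rewrite diracT.
under eq_bigr do rewrite diracT mule1.
by rewrite sumEFin s1.
Qed.

HB.instance Definition _ s :=
  Measure_isProbability.Build _ _ _ (dirac_mix_fun s) (dirac_mixT s).

Definition dirac_mix s : probability T R := dirac_mix_fun s.

Lemma dirac_mixE s A : is_weighting s ->
  dirac_mix s A = (\sum_(wa <- s) wa.1%:E * \d_wa.2 A)%E.
Proof. by rewrite /dirac_mix /= /dirac_mix_fun => ->. Qed.

End dirac_mix.

Section couplings.
Context {R : realType}.
Implicit Types mu nu : probability R R.

Definition couplings mu nu : set (probability (R * R)%type R) :=
  [set pi | (forall A, measurable A -> pi (A `*` [set: R]) = mu A) /\
            (forall B, measurable B -> pi ([set: R] `*` B) = nu B)].

(* The kernel is mu-a.e. unique, so that asking for one disintegration with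
   barycentres x is asking it for all of them. *)
Definition martingale_couplings mu nu : set (probability (R * R)%type R) :=
  [set pi | couplings mu nu pi /\
    exists k : R.-pker R ~> R,
      (forall A B, measurable A -> measurable B ->
         pi (A `*` B) = \int[mu]_(x in A) k x B)%E /\
      {ae mu, forall x, (k x).-integrable [set: R] (fun y => y%:E) /\
                        (\int[k x]_y y%:E = x%:E)%E}].

End couplings.

Section square_displacement.
Context {R : realType}.

Definition sq (xy : R * R) : R := (xy.2 - xy.1) ^+ 2.

Lemma measurable_sq : measurable_fun [set: (R * R)%type] sq.
Proof.
apply: measurable_funX; apply: measurable_funB.
  exact: measurable_snd.
exact: measurable_fst.
Qed.

HB.instance Definition _ := isMeasurableFun.Build _ _ _ _ sq measurable_sq.

Definition sq_image (pi : probability (R * R)%type R) : probability R R :=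
  distribution pi sq.

End square_displacement.

Section convex_order.
Context {R : realType}.
Implicit Types (eta theta : probability R R) (S : set (probability R R)).

Definition finite_first_moment eta : Prop :=
  eta.-integrable [set: R] (fun x => x%:E).

(* Under the first moment conditions the negative part of phi is integrable,
   so both integrals are well defined in ]-oo, +oo]. *)
Definition cx_le eta theta : Prop :=
  [/\ finite_first_moment eta, finite_first_moment theta &
      forall phi : R -> R, convex_function [set: R] phi ->
        (\int[eta]_x (phi x)%:E <= \int[theta]_x (phi x)%:E)%E].

Definition is_inf_cx S eta : Prop :=
  [/\ finite_first_moment eta,
      forall theta, S theta -> cx_le eta theta &
      forall eta', finite_first_moment eta' ->
        (forall theta, S theta -> cx_le eta' theta) -> cx_le eta' eta].

Definition is_sup_cx S theta : Prop :=
  [/\ finite_first_moment theta,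
      forall eta, S eta -> cx_le eta theta &
      forall theta', finite_first_moment theta' ->
        (forall eta, S eta -> cx_le eta theta') -> cx_le theta theta'].

End convex_order.

(* Main.v *)
From HB Require Import structures.
Require Import Defs.
From mathcomp Require Import all_boot all_order all_algebra.
From mathcomp Require Import all_classical all_reals all_analysis.
From mathcomp Require Import measurable_realfun ring lra.

Set Implicit Arguments.
Unset Strict Implicit.
Unset Printing Implicit Defensive.

Import Order.TTheory GRing.Theory Num.Theory.
Local Open Scope classical_set_scope.
Local Open Scope ring_scope.

(** Since [mu] has two atoms and [nu] four, a martingale coupling is a table of
    eight masses, the masses sent by [xm] to the four points of [nu] having the
    right total and barycentre ([martingale_couplings_atomic]). The coupling in
    the theorem sends [xm] to one pair of these points and [xp] to the other
    pair, so that any competitor differs from it by an exchange: masses [e] and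
    [f] at the first pair go over to [xp], masses [c] and [g] at the second
    pair go over to [xm], with [c + g = e + f] and equal first moments
    ([binary_target_perturbation]).

    Such an exchange moves the law of the square displacement in the convex
    order ([crossing_le]). For [pi_up], it removes mass from the squares of
    [xm - ym], [zm - xm], [xp - yp], [zp - xp] and adds mass at the squares of
    [xm - yp], [zm - xp], which are smaller by the last hypothesis, and of
    [xp - ym], [zp - xm]. The total mass and the mean do not change. If the last
    two numbers were larger than all the distances that lose mass, this would
    be a spread out of an interval, and the integral of a convex function would
    increase. By the order of the points and the first two hypotheses they are,
    except that [zp - xp] may exceed [xp - ym], or [xm - ym] exceed [zp - xm].
    But [zp - xp] is smaller than [zp - xm], where the same mass [g] is added
    (likewise [xm - ym], [xp - ym] and [e]), and to the right of a chord a
    convex function minus the chord increases ([convex_swap_le]). For [pi_down]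
    the exchanges are the reverse ones, so that the same inequality makes its
    image a maximum.

    Thus the infimum and the supremum are attained, at [pi_up] and [pi_down]. *)

(** * Convex functions and spreads *)

(** Convexity on the line with the denominators cleared, so that degenerate
    triples need no separate treatment. *)
Definition three_point {R : realFieldType} (psi : R -> R) : Prop :=
  forall a b c, a <= b -> b <= c ->
    (c - a) * psi b <= (c - b) * psi a + (b - a) * psi c.

Lemma convex_function_three_point {R : realType} (phi : R -> R) :
  convex_function [set: R] phi -> three_point phi.
Proof.
move=> cphi a b c ab bc.
have [ac|ca] := ltP a c; last first.
  have -> : b = a by apply/eqP; rewrite eq_le ab (le_trans bc).
  have -> : c = a by apply/eqP; rewrite eq_le ca (le_trans ab bc).
  by rewrite subrr !mul0r addr0.
have ca0 : 0 < c - a by rewrite subr_gt0.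
have t0 : 0 <= (c - b) / (c - a) by rewrite divr_ge0 ?subr_ge0// ltW.
have t1 : (c - b) / (c - a) <= 1 by rewrite ler_pdivrMr// mul1r lerD2l lerN2.
have : phi ((c - b) / (c - a) * a + (1 - (c - b) / (c - a)) * c) <=
       (c - b) / (c - a) * phi a + (1 - (c - b) / (c - a)) * phi c.
  by apply: (cphi (Itv01 t0 t1) a c); rewrite inE.
have -> : (c - b) / (c - a) * a + (1 - (c - b) / (c - a)) * c = b.
  by field; rewrite gt_eqF.
rewrite -(ler_pM2l ca0) => /le_trans; apply; rewrite le_eqVlt; apply/orP; left.
by apply/eqP; field; rewrite gt_eqF.
Qed.

(** The sublevel sets of a convex function are intervals. *)
Lemma convex_measurable {R : realType} (phi : R -> R) :
  convex_function [set: R] phi -> measurable_fun [set: R] phi.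
Proof.
move=> /convex_function_three_point cphi.
move=> mT; apply: (measurability _ (RGenOInfty.measurableE R)) => //.
move=> _ [_ [r ->] <-]; rewrite setTI -[X in measurable X]setCK.
apply: measurableC; rewrite preimage_setC setCitvr.
apply: is_interval_measurable => a c /=.
rewrite !in_itv/= => ar cr b /andP[ab bc]; rewrite in_itv/=.
have [ac|ca] := ltP a c; last first.
  by have -> : b = a by apply/eqP; rewrite eq_le ab (le_trans bc).
have := cphi _ _ _ ab bc; nra.
Qed.

Lemma three_point_affine {R : realFieldType} (phi : R -> R) (u v : R) :
  three_point phi -> three_point (fun t => phi t - (u + v * t)).
Proof. move=> h a b c ab bc /=; have := h _ _ _ ab bc; lra. Qed.

(** In this section [psi] stands for a convex function minus its chord over
    [m, M]. *)
Section chord.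
Context {R : realFieldType} (psi : R -> R) (m M : R).
Hypotheses (psi3 : three_point psi) (mM : m < M) (psim : psi m = 0)
  (psiM : psi M = 0).

Lemma three_point_inside t : m <= t -> t <= M -> psi t <= 0.
Proof.
move=> mt tM; have := psi3 mt tM.
by rewrite psim psiM !mulr0 addr0 pmulr_rle0// subr_gt0.
Qed.

Lemma three_point_left t : t <= m -> 0 <= psi t.
Proof.
move=> tm; have := psi3 tm (ltW mM).
by rewrite psim psiM !mulr0 addr0 pmulr_rge0// subr_gt0.
Qed.

Lemma three_point_right s t : M <= s -> s <= t -> psi s <= psi t.
Proof.
move=> Ms st; have [tM|Mt] := leP t M.
  have -> : s = M by lra.
  by have -> : t = M by lra.
have psit : 0 <= psi t.
  have := psi3 (ltW mM) (ltW Mt).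
  by rewrite psim psiM !mulr0 add0r pmulr_rge0// subr_gt0.
have := psi3 Ms st; rewrite psiM mulr0 add0r => le_s.
rewrite -(@ler_pM2l _ (t - M)) ?subr_gt0//; apply: le_trans le_s _.
by rewrite ler_wpM2r// lerD2r.
Qed.

End chord.

(** Subtract from [phi] its chord over [m, h1]: by the equality of masses and of
    means this changes both sides by the same amount. The difference [psi] is
    nonpositive at [s1], [s2], [s3], nonnegative at [l1], [l2], zero at [h1];
    and [psi s4 <= psi h2], even when [s4] lies beyond [h1], which is why [s4]
    is paired with [h2] through the common weight [g]. *)
Lemma convex_swap_le_ordered {R : realFieldType} (phi : R -> R) (c e f g : R)
    (m l1 l2 h1 h2 s1 s2 s3 s4 : R) : three_point phi ->
  0 <= c -> 0 <= e -> 0 <= f -> 0 <= g -> c + g = e + f ->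
  l1 <= m -> l2 <= m -> m < h1 -> h1 <= h2 ->
  m <= s1 <= h1 -> m <= s2 <= h1 -> m <= s3 <= h1 -> m <= s4 <= h2 ->
  c * l1 + f * l2 + e * h1 + g * h2 = e * s1 + c * s2 + f * s3 + g * s4 ->
  e * phi s1 + c * phi s2 + f * phi s3 + g * phi s4 <=
  c * phi l1 + f * phi l2 + e * phi h1 + g * phi h2.
Proof.
move=> phi3 c0 e0 f0 g0 mass lm1 lm2 mh1 h12.
move=> /andP[ms1 sh1] /andP[ms2 sh2] /andP[ms3 sh3] /andP[ms4 sh4] mean.
pose r := (phi h1 - phi m) / (h1 - m).
pose psi t := phi t - (phi m - r * m + r * t).
have psi3 : three_point psi by exact: three_point_affine.
have psim : psi m = 0 by rewrite /psi; ring.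
have psih : psi h1 = 0.
  by rewrite /psi /r; field; rewrite subr_eq0 gt_eqF.
have phiE t : phi t = psi t + (phi m - r * m + r * t) by rewrite /psi; ring.
have inside := three_point_inside psi3 mh1 psim psih.
have left := three_point_left psi3 mh1 psim psih.
have right := three_point_right psi3 mh1 psim psih.
suff : e * psi s1 + c * psi s2 + f * psi s3 + g * psi s4 <=
       c * psi l1 + f * psi l2 + e * psi h1 + g * psi h2.
  have := congr1 ( *%R r) mean.
  have := congr1 ( *%R (phi m - r * m)) mass.
  rewrite (phiE s1) (phiE s2) (phiE s3) (phiE s4) (phiE l1) (phiE l2)
    (phiE h1) (phiE h2); lra.
have psi_h2 : 0 <= psi h2 by rewrite -psih; exact: right.
have psi_s4 : psi s4 <= psi h2.
  have [s4h|hs4] := leP s4 h1; first exact: le_trans (inside _ ms4 s4h) _.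
  exact: right (ltW hs4) sh4.
have := ler_wpM2l e0 (inside _ ms1 sh1).
have := ler_wpM2l c0 (inside _ ms2 sh2).
have := ler_wpM2l f0 (inside _ ms3 sh3).
have := ler_wpM2l g0 psi_s4.
have := mulr_ge0 c0 (left _ lm1); have := mulr_ge0 f0 (left _ lm2).
rewrite psih; lra.
Qed.

(** The statement is invariant under exchanging [(e, s1, h1)] with [(g, s4, h2)]
    and [(c, l1, s2)] with [(f, l2, s3)], so either order of [h1] and [h2] is
    covered. *)
Lemma convex_swap_le {R : realFieldType} (phi : R -> R) (c e f g : R)
    (m l1 l2 h1 h2 s1 s2 s3 s4 : R) : three_point phi ->
  0 <= c -> 0 <= e -> 0 <= f -> 0 <= g -> c + g = e + f ->
  l1 <= m -> l2 <= m -> m < h1 -> m < h2 ->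
  m <= s1 <= h1 -> m <= s2 -> s2 <= h1 -> s2 <= h2 ->
  m <= s3 -> s3 <= h1 -> s3 <= h2 -> m <= s4 <= h2 ->
  c * l1 + f * l2 + e * h1 + g * h2 = e * s1 + c * s2 + f * s3 + g * s4 ->
  e * phi s1 + c * phi s2 + f * phi s3 + g * phi s4 <=
  c * phi l1 + f * phi l2 + e * phi h1 + g * phi h2.
Proof.
move=> phi3 c0 e0 f0 g0 mass lm1 lm2 mh1 mh2 S1 ms2 s2h1 s2h2 ms3 s3h1 s3h2 S4.
move=> mean; have [h12|/ltW h21] := leP h1 h2.
  apply: (convex_swap_le_ordered (m := m)) => //; exact/andP.
have : g * phi s4 + f * phi s3 + c * phi s2 + e * phi s1 <=
       f * phi l2 + c * phi l1 + g * phi h2 + e * phi h1.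
  apply: (convex_swap_le_ordered (m := m)) => //; try exact/andP; lra.
lra.
Qed.

(** Letting [xm] and [xp] exchange the masses [c], [g] of [yp], [zp] against the
    masses [e], [f] of [ym], [zm] spreads the square displacement. The
    threshold between the small squares that gain mass and those that lose it
    is the square of [Num.max (xm - yp) (zm - xp)]. *)
Lemma crossing_le {R : realType} (ym yp xm xp zm zp : R) (phi : R -> R)
    (c e f g : R) :
  ym < yp -> yp < xm -> xm < xp -> xp < zm -> zm < zp ->
  xp - ym >= zm - xm -> zp - xm >= xp - yp ->
  Num.min (Num.min (Num.min (xm - ym) (xp - yp)) (zm - xm)) (zp - xp)
    >= Num.max (xm - yp) (zm - xp) ->
  convex_function [set: R] phi ->
  0 <= c -> 0 <= e -> 0 <= f -> 0 <= g ->
  c + g = e + f -> c * yp + g * zp = e * ym + f * zm ->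
  e * phi (sq (xm, ym)) + f * phi (sq (xm, zm)) +
    c * phi (sq (xp, yp)) + g * phi (sq (xp, zp)) <=
  c * phi (sq (xm, yp)) + g * phi (sq (xm, zp)) +
    e * phi (sq (xp, ym)) + f * phi (sq (xp, zm)).
Proof.
move=> ym_yp yp_xm xm_xp xp_zm zm_zp h1 h2 h3.
move=> /convex_function_three_point phi3 c0 e0 f0 g0 mass mean.
pose k : R := Num.max (xm - yp) (zm - xp).
have [] : [/\ k <= xm - ym, k <= xp - yp, k <= zm - xm & k <= zp - xp].
  by move: h3; rewrite !le_min => /andP[/andP[/andP[-> ->] ->] ->].
move=> k1 k2 k3 k4.
have [k5 k6] : xm - yp <= k /\ zm - xp <= k.
  by split; rewrite le_max lexx ?orbT.
have k0 : 0 < k by lra.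
clearbody k.
have sqC (x y : R) : sq (x, y) = (x - y) ^+ 2 by rewrite /sq /=; ring.
have sqE (x y : R) : sq (x, y) = (y - x) ^+ 2 by [].
have le_sqr (a b : R) : 0 <= a -> a <= b -> a ^+ 2 <= b ^+ 2 :> R.
  by move=> a0 ab; rewrite lerXn2r// nnegrE (le_trans a0).
have lt_sqr (a b : R) : 0 <= a -> a < b -> a ^+ 2 < b ^+ 2 :> R.
  by move=> a0 ab; rewrite ltrXn2r// nnegrE (le_trans a0)// ltW.
have swap : e * phi (sq (xm, ym)) + c * phi (sq (xp, yp)) +
      f * phi (sq (xm, zm)) + g * phi (sq (xp, zp)) <=
    c * phi (sq (xm, yp)) + f * phi (sq (xp, zm)) +
      e * phi (sq (xp, ym)) + g * phi (sq (xm, zp)).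
  rewrite (sqC xm ym) (sqC xp yp) (sqE xm zm) (sqE xp zp) (sqC xm yp)
    (sqE xp zm) (sqC xp ym) (sqE xm zp).
  apply: (convex_swap_le (m := k ^+ 2)) => //;
    try (apply/andP; split); try (apply: le_sqr; lra); try (apply: lt_sqr; lra).
  (* the two means of the squares differ by a combination of [mass] and [mean]:
     the squares of the targets cancel *)
  have := congr1 ( *%R (xp - xm)) mean.
  have := congr1 ( *%R (xp ^+ 2 - xm ^+ 2)) mass.
  lra.
lra.
Qed.

(** * Measures with finitely many atoms *)

Section atomic.
Context d (T : measurableType d) (R : realType).
Implicit Types (m : {measure set T -> \bar R}) (s : seq (R * T)).
Local Open Scope ereal_scope.

(** The points of [s] may repeat and [m] is known on measurable sets only; this
    relation is used instead of an equality with [dirac_mix s] because it also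
    applies to the values of a kernel. *)
Definition atomic m s : Prop :=
  all (fun wa => 0 <= wa.1)%R s /\
  forall A, measurable A -> m A = \sum_(wa <- s) wa.1%:E * \d_wa.2 A.

Lemma dirac_mix_atomic s : is_weighting s -> atomic (dirac_mix s) s.
Proof. by move=> sW; split=> [|A _]; [case/andP: sW|exact: dirac_mixE]. Qed.

Lemma atomic_ge0_integral m s (D : set T) (f : T -> \bar R) :
  atomic m s -> measurable D -> measurable_fun D f ->
  (forall x, D x -> 0 <= f x) ->
  \int[m]_(x in D) f x = \sum_(wa <- s) wa.1%:E * (\d_wa.2 D * f wa.2).
Proof.
move=> [s0 mE] mD mf f0; elim: s s0 m mE => [_|[w a] s IH /= /andP[w0 s0]] m mE.
  rewrite big_nil (eq_measure_integral mzero) ?integral_measure_zero// => A mA _.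
  by rewrite mE// big_nil.
have [m' m'E] := dirac_mix_measureP s0.
rewrite big_cons (eq_measure_integral
  (measure_add (mscale (NngNum w0) \d_a) m')); last first.
  by move=> A mA _; rewrite mE// big_cons [RHS]measure_addE -m'E.
rewrite ge0_integral_measure_add// ge0_integral_mscale// integral_dirac//.
by congr (_ + _); apply: IH => // A _; rewrite -m'E.
Qed.

Lemma atomic_integral m s (f : T -> R) : atomic m s ->
  measurable_fun [set: T] f ->
  \int[m]_x (f x)%:E = (\sum_(wa <- s) wa.1 * f wa.2)%:E.
Proof.
move=> ms mf; have mf' : measurable_fun [set: T] (EFin \o f).
  exact/measurable_EFinP.
rewrite integralE !(atomic_ge0_integral ms)//; last 2 first.
- exact: measurable_funeneg.
- exact: measurable_funepos.
under eq_bigr do rewrite diracT mul1e funeposE /= -EFin_max -EFinM.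
under [X in _ - X]eq_bigr do rewrite diracT mul1e funenegE /= -EFin_max -EFinM.
rewrite !sumEFin -EFinB -sumrB; congr _%:E; apply: eq_bigr => wa _.
rewrite -mulrBr; congr (_ * _)%R.
by case: (leP (f wa.2) 0%R) => f0; case: (leP (- f wa.2)%R 0%R) => Nf0; lra.
Qed.

Lemma atomic_integrable m s (f : T -> R) : atomic m s ->
  measurable_fun [set: T] f -> m.-integrable [set: T] (EFin \o f).
Proof.
move=> ms mf; apply/integrableP; split; first exact/measurable_EFinP.
rewrite (atomic_ge0_integral ms)//; last first.
  by apply: measurableT_comp => //; exact/measurable_EFinP.
under eq_bigr do rewrite diracT mul1e /= -EFinM.
by rewrite sumEFin ltry.
Qed.

Lemma measurable_seq (xs : seq T) :
  (forall x : T, measurable [set x]) -> measurable [set` xs].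
Proof.
move=> m1; elim: xs => [|x xs IH]; first by rewrite classical_sets.set_nil.
suff -> : [set` x :: xs] = [set x] `|` [set` xs] by exact: measurableU.
apply/seteqP; split=> y /=; rewrite inE; first by case/orP=> [/eqP|]; [left|right].
by case=> [->|->]; rewrite ?eqxx ?orbT.
Qed.

Lemma measure_setI_seq m (xs : seq T) (A : set T) :
  (forall x : T, measurable [set x]) -> measurable A -> uniq xs ->
  m (A `&` [set` xs]) = \sum_(x <- xs) m [set x] * \d_x A.
Proof.
move=> m1 mA.
elim: xs => [_|x xs IH /= /andP[xxs uxs]].
  by rewrite classical_sets.set_nil setI0 measure0 big_nil.
have mAxs : measurable (A `&` [set` x :: xs]) by exact/measurableI/measurable_seq.
rewrite big_cons -IH// (measureDI m mAxs (m1 x)) addeC; congr (_ + _).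
  rewrite diracE; case: (boolP (x \in A)) => xA.
    rewrite mule1; congr (m _); apply/seteqP; split=> [y [_ ->]//|_ ->].
    by split=> //; split; [exact/set_mem|rewrite /= mem_head].
  rewrite mule0 -(measure0 m); congr (m _); apply/seteqP; split=> // y [[Ay _] yx].
  by move/negP: xA; apply; apply/mem_set; rewrite -yx.
congr (m _); apply/seteqP; split=> y.
  move=> [[Ay]] /=; rewrite inE => /orP[/eqP->|yxs] // _.
move=> [Ay /= yxs]; split; first by split=> //=; rewrite inE yxs orbT.
by move=> /= yx; move: xxs; rewrite -yx yxs.
Qed.

(** A finite measure carried by finitely many points is the combination of the
    Dirac masses there; this is how couplings and kernels that are given
    abstractly become explicit. *)
Lemma atomic_of_support m (xs : seq T) :
  (forall x : T, measurable [set x]) ->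
  (forall A, measurable A -> m A \is a fin_num) ->
  uniq xs -> m (~` [set` xs]) = 0 ->
  atomic m [seq (fine (m [set x]), x) | x <- xs].
Proof.
move=> m1 mfin uxs mxs; split.
  by apply/allP => _ /mapP[x _ ->] /=; exact/fine_ge0.
have mX := measurable_seq xs m1.
move=> A mA; rewrite big_map /= (measureDI m mA mX).
rewrite [X in X + _](_ : _ = 0).
  rewrite add0e; apply: etrans (measure_setI_seq m m1 mA uxs) _.
  apply: eq_bigr => x _.
  by rewrite fineK//; exact: mfin.
apply/eqP; rewrite -measure_le0 -mxs le_measure ?inE//.
- exact: measurableD.
- exact: measurableC.
Qed.

End atomic.

(** * Martingale couplings of a two-point law *)

Section two_point.
Context {R : realType}.
Implicit Types (nu : probability R R) (pi : probability (R * R)%type R).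

Lemma sq_image_atomic pi s : atomic pi s ->
  atomic (sq_image pi) [seq (wa.1, sq wa.2) | wa <- s].
Proof.
move=> [s0 piE]; split.
  by apply/allP => _ /mapP[wa /(allP s0) ? ->].
move=> A mA; rewrite big_map /=.
have mB : measurable (sq @^-1` A).
  by rewrite -[X in measurable X]setTI; exact: measurable_sq.
exact: (piE _ mB).
Qed.

Lemma measurable_prod_set1 (z : R * R) : measurable [set z].
Proof.
suff -> : [set z] = [set z.1] `*` [set z.2] by exact: measurableX.
by case: z => x y; apply/seteqP; split=> [_ ->//|[a b] /= [-> ->]].
Qed.

Definition two_point (p x1 x2 : R) : probability R R :=
  dirac_mix [:: (p, x1); (1 - p, x2)].

Lemma two_point_atomic (p x1 x2 : R) : 0 < p < 1 ->
  atomic (two_point p x1 x2) [:: (p, x1); (1 - p, x2)].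
Proof.
move=> /andP[p0 p1]; apply: dirac_mix_atomic; rewrite /is_weighting /=.
rewrite !big_cons big_nil /= ltW//= subr_ge0 ltW//=.
by apply/eqP; ring.
Qed.

Lemma two_point_integral (p x1 x2 : R) (A : set R) (h : R -> \bar R) :
  0 < p < 1 -> measurable A -> measurable_fun [set: R] h ->
  (forall x, 0 <= h x)%E ->
  (\int[two_point p x1 x2]_(x in A) h x =
   p%:E * (\d_x1 A * h x1) + (1 - p)%:E * (\d_x2 A * h x2))%E.
Proof.
move=> p01 mA mh h0; rewrite (atomic_ge0_integral (two_point_atomic _ _ p01))//.
  by rewrite !big_cons big_nil /= adde0.
exact: measurable_funTS.
Qed.

(** Both atoms have positive mass, hence escape every null set. *)
Lemma two_point_ae (p x1 x2 : R) (P : R -> Prop) : 0 < p < 1 ->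
  {ae two_point p x1 x2, forall x, P x} -> P x1 /\ P x2.
Proof.
move=> /[dup] p01 /andP[p0 p1] [N [mN N0 PN]].
move: N0; rewrite (proj2 (two_point_atomic x1 x2 p01))//.
rewrite !big_cons big_nil /= adde0 !diracE -!EFinM -EFinD => /eqP.
rewrite eqe => /eqP N0.
have [x1N x2N] : x1 \notin N /\ x2 \notin N.
  by move: N0; case: (x1 \in N); case: (x2 \in N) => //= N0; exfalso; lra.
split; apply: contrapT => Px.
  by move/negP: x1N; apply; apply/mem_set/PN.
by move/negP: x2N; apply; apply/mem_set/PN.
Qed.

Definition pair_atoms (x : R) (w : R -> R) (ys : seq R) : seq (R * (R * R)) :=
  [seq (w y, (x, y)) | y <- ys].

(** The kernel is determined at the two atoms of the first marginal, where it is
    carried by the support [ys] of the second one; [w1] and [w2] are its values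
    there, weighted by [p] and [1 - p]. *)
Lemma martingale_couplings_atomic (p x1 x2 : R) (ys : seq R) nu pi :
  0 < p < 1 -> x1 != x2 -> uniq ys -> nu (~` [set` ys]) = 0%E ->
  martingale_couplings (two_point p x1 x2) nu pi ->
  exists w1 w2 : R -> R,
    [/\ (forall y, 0 <= w1 y) /\ (forall y, 0 <= w2 y),
        \sum_(y <- ys) w1 y = p /\ \sum_(y <- ys) w1 y * y = p * x1,
        \sum_(y <- ys) w2 y = 1 - p /\ \sum_(y <- ys) w2 y * y = (1 - p) * x2,
        forall y, nu [set y] = (w1 y + w2 y)%:E &
        atomic pi (pair_atoms x1 w1 ys ++ pair_atoms x2 w2 ys)].
Proof.
move=> /[dup] p01 /andP[p0 p1] x12 uys nuys [[_ pinu] [k [kE kmart]]].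
have [[int1 mean1] [int2 mean2]] := two_point_ae p01 kmart.
have p'0 : 0 < 1 - p by lra.
have piE A B : measurable A -> measurable B ->
    (pi (A `*` B) = p%:E * (\d_x1 A * k x1 B) + (1 - p)%:E * (\d_x2 A * k x2 B))%E.
  move=> mA mB; rewrite kE// two_point_integral//.
  exact: measurable_kernel.
have nuE B : measurable B ->
    (nu B = p%:E * k x1 B + (1 - p)%:E * k x2 B)%E.
  by move=> mB; rewrite -pinu// piE// !diracT !mul1e.
have mys : measurable (~` [set` ys]).
  by apply: measurableC; apply: measurable_seq => y.
have [k1ys k2ys] : k x1 (~` [set` ys]) = 0%E /\ k x2 (~` [set` ys]) = 0%E.
  move: nuys; rewrite nuE// => /eqP.
  rewrite padde_eq0; [|by rewrite mule_ge0// lee_fin ltW..].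
  by rewrite !mule_eq0 !eqe (gt_eqF p0) (gt_eqF p'0)/= => /andP[/eqP ? /eqP].
have kfin x A : measurable A -> k x A \is a fin_num.
  move=> mA; rewrite ge0_fin_numE//.
  apply: le_lt_trans (ltry 1); rewrite -(prob_kernel (s := k) x).
  by rewrite le_measure ?inE.
have k1E := atomic_of_support (m := k x1) _ (kfin x1) uys k1ys.
have k2E := atomic_of_support (m := k x2) _ (kfin x2) uys k2ys.
have mass x : atomic (k x) [seq (fine (k x [set y]), y) | y <- ys] ->
    \sum_(y <- ys) fine (k x [set y]) = 1.
  move=> [_ /(_ _ measurableT)]; rewrite prob_kernel big_map /=.
  by under eq_bigr do rewrite diracT mule1; rewrite sumEFin => -[].
have mean x : atomic (k x) [seq (fine (k x [set y]), y) | y <- ys] ->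
    (\int[k x]_y y%:E = x%:E)%E -> \sum_(y <- ys) fine (k x [set y]) * y = x.
  by move=> /atomic_integral -> //; rewrite big_map => -[].
exists (fun y => p * fine (k x1 [set y])), (fun y => (1 - p) * fine (k x2 [set y])).
split.
- by split=> y; rewrite mulr_ge0 ?fine_ge0// ltW.
- split; first by rewrite -mulr_sumr mass ?mulr1//; exact: k1E.
  under eq_bigr do rewrite -mulrA.
  by rewrite -mulr_sumr (mean x1)//; exact: k1E.
- split; first by rewrite -mulr_sumr mass ?mulr1//; exact: k2E.
  under eq_bigr do rewrite -mulrA.
  by rewrite -mulr_sumr (mean x2)//; exact: k2E.
- by move=> y; rewrite nuE//= [RHS]EFinD !EFinM !fineK//; exact: kfin.
(* [pi] does not charge the complement of this finite product, as it does not
   charge [~` [set x1; x2] `*` setT] and [setT `*` ~` [set` ys]] *)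
pose xys := [seq (x1, y) | y <- ys] ++ [seq (x2, y) | y <- ys].
have -> : pair_atoms x1 (fun y => p * fine (k x1 [set y])) ys ++
    pair_atoms x2 (fun y => (1 - p) * fine (k x2 [set y])) ys =
    [seq (fine (pi [set z]), z) | z <- xys].
  have piz x y : pi [set (x, y)] = pi ([set x] `*` [set y]).
    by congr (pi _); apply/seteqP; split=> [_ ->//|[a b] /= [-> ->]].
  rewrite map_cat -!map_comp; congr (_ ++ _); apply: eq_map => y /=.
    rewrite piz piE// !diracE mem_set// memNset ?mul0e ?mule0 ?adde0 ?mul1e.
      by rewrite fineM// kfin.
    by move=> /= x21; rewrite x21 eqxx in x12.
  rewrite piz piE// !diracE memNset ?mem_set// ?mul0e ?mule0 ?add0e ?mul1e.
    by rewrite fineM// kfin.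
  by move=> /= x21; rewrite x21 eqxx in x12.
apply: atomic_of_support => [z|A mA| |].
- exact: measurable_prod_set1.
- exact: fin_num_measure.
- rewrite cat_uniq !map_inj_uniq ?uys ?andbT//=; try by move=> y z [].
  by apply/hasPn => _ /mapP[y _ ->]; apply/mapP => -[z _ [x21]];
    rewrite x21 eqxx in x12.
have mx12 : measurable (~` [set x1; x2]).
  by apply: measurableC; exact: measurableU.
apply: measure_negligible.
  by apply: measurableC; apply: measurable_seq; exact: measurable_prod_set1.
apply: (@negligibleS _ _ _ _
  ((~` [set x1; x2]) `*` setT `|` setT `*` ~` [set` ys])).
  move=> [x y] /= xyN; apply: contrapT => /not_orP[/= xN yN]; apply: xyN.
  have [y_ys x_xs] : y \in ys /\ (x = x1 \/ x = x2).
    by split; apply: contrapT => ?; [apply: yN | apply: xN].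
  by rewrite mem_cat; apply/orP; case: x_xs => ->; [left|right]; apply: map_f.
have null A : measurable A -> pi A = 0%E -> pi.-negligible A.
  by move=> mA A0; exact/negligibleP.
apply: negligibleU; apply: null; try exact: measurableX.
  by rewrite piE// !diracE !memNset ?mul0e ?mule0 ?adde0//= => /not_orP[].
by rewrite piE// k1ys k2ys !mule0 adde0.
Qed.

End two_point.

Section two_kernel.
Context {R : realType}.
Variables (x1 : R) (P Q : probability R R).

(** A coupling whose first marginal is carried by [x1] and one more point
    disintegrates along such a kernel. *)
Definition two_kernel (x : R) : {measure set R -> \bar R} :=
  if x == x1 then P else Q.

Let measurable_two_kernel U :
  measurable U -> measurable_fun [set: R] (two_kernel ^~ U).
Proof.
move=> mU; suff -> : two_kernel ^~ U = fun x => if x == x1 then P U else Q U.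
  by apply: measurable_fun_ifT => //; exact: measurable_fun_eqr.
by apply/funext => x; rewrite /two_kernel; case: ifP.
Qed.

HB.instance Definition _ :=
  isKernel.Build _ _ _ _ _ two_kernel measurable_two_kernel.

Let two_kernel_prob x : two_kernel x [set: R] = 1%E.
Proof. by rewrite /two_kernel; case: ifP => _; exact: probability_setT. Qed.

HB.instance Definition _ :=
  Kernel_isProbability.Build _ _ _ _ _ two_kernel two_kernel_prob.

End two_kernel.

Lemma martingale_couplings_two_kernel {R : realType} (p x1 x2 : R)
    (P Q nu : probability R R) (pi : probability (R * R)%type R) :
  0 < p < 1 -> x1 != x2 ->
  P.-integrable [set: R] EFin -> (\int[P]_y y%:E = x1%:E)%E ->
  Q.-integrable [set: R] EFin -> (\int[Q]_y y%:E = x2%:E)%E ->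
  (forall B, measurable B -> nu B = p%:E * P B + (1 - p)%:E * Q B)%E ->
  (forall A B, measurable A -> measurable B ->
    pi (A `*` B) = p%:E * (\d_x1 A * P B) + (1 - p)%:E * (\d_x2 A * Q B))%E ->
  martingale_couplings (two_point p x1 x2) nu pi.
Proof.
move=> p01 x12 intP meanP intQ meanQ nuE piE.
have k1 : two_kernel x1 P Q x1 = P by rewrite /two_kernel eqxx.
have k2 : two_kernel x1 P Q x2 = Q.
  by rewrite /two_kernel eq_sym (negbTE x12).
split; first split=> A mA.
- rewrite piE// !probability_setT !mule1 (proj2 (two_point_atomic x1 x2 p01))//.
  by rewrite !big_cons big_nil /= adde0.
- by rewrite piE// nuE// !diracT !mul1e.
exists (two_kernel x1 P Q); split=> [A B mA mB|].
  rewrite two_point_integral//; last exact: measurable_kernel.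
  rewrite piE//; pose ev m : \bar R := (m : {measure set R -> \bar R}) B.
  by congr (_ * (_ * _) + _ * (_ * _))%E; [exact: (congr1 ev (esym k1)) |
    exact: (congr1 ev (esym k2))].
exists (~` [set x1; x2]); split.
- by apply: measurableC; exact: measurableU.
- rewrite (proj2 (two_point_atomic x1 x2 p01)); last first.
    by apply: measurableC; exact: measurableU.
  rewrite !big_cons big_nil /= !diracE !memNset ?mule0 ?adde0//=; tauto.
have k1P : (two_kernel x1 P Q x1).-integrable [set: R] EFin /\
    (\int[two_kernel x1 P Q x1]_y y%:E = x1%:E)%E by rewrite k1.
have k2Q : (two_kernel x1 P Q x2).-integrable [set: R] EFin /\
    (\int[two_kernel x1 P Q x2]_y y%:E = x2%:E)%E by rewrite k2.
by move=> x xN [] xE; apply: xN; rewrite xE.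
Qed.

(** * Couplings that split each atom in two *)

(** The parameters are instantiated with [(ym, zm)] around [xm] and [(yp, zp)]
    around [xp] for the lower bound, and with the two pairs exchanged for the
    upper bound. *)
Section binary.
Context {R : realType}.
Variables (p x1 a1 b1 x2 a2 b2 : R).

Definition binary_atoms : seq (R * (R * R)) :=
  [:: (p * ((b1 - x1) / (b1 - a1)), (x1, a1));
      (p * ((x1 - a1) / (b1 - a1)), (x1, b1));
      ((1 - p) * ((b2 - x2) / (b2 - a2)), (x2, a2));
      ((1 - p) * ((x2 - a2) / (b2 - a2)), (x2, b2))].

Definition binary_coupling : probability (R * R)%type R := dirac_mix binary_atoms.

Definition binary_target : probability R R :=
  dirac_mix [seq (wa.1, wa.2.2) | wa <- binary_atoms].

Hypotheses (p01 : 0 < p < 1) (x12 : x1 != x2)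
  (ax1 : a1 < x1) (xb1 : x1 < b1) (ax2 : a2 < x2) (xb2 : x2 < b2).

Let ba1 : b1 - a1 != 0. Proof. by rewrite subr_eq0 gt_eqF// (lt_trans ax1). Qed.
Let ba2 : b2 - a2 != 0. Proof. by rewrite subr_eq0 gt_eqF// (lt_trans ax2). Qed.

Definition binary_law (a x b : R) : probability R R :=
  dirac_mix [:: ((b - x) / (b - a), a); ((x - a) / (b - a), b)].

Lemma binary_law_atomic a x b : a < x -> x < b ->
  atomic (binary_law a x b) [:: ((b - x) / (b - a), a); ((x - a) / (b - a), b)].
Proof.
move=> ax xb; apply: dirac_mix_atomic; rewrite /is_weighting /=.
rewrite !big_cons big_nil /= !divr_ge0 ?subr_ge0 ?(ltW ax, ltW xb,
  ltW (lt_trans ax xb))//=.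
by apply/eqP; field; rewrite subr_eq0 gt_eqF// (lt_trans ax).
Qed.

Lemma binary_law_mean a x b : a < x -> x < b ->
  (\int[binary_law a x b]_y y%:E = x%:E)%E.
Proof.
move=> ax xb; rewrite (atomic_integral (binary_law_atomic ax xb))//.
rewrite !big_cons big_nil /=; congr _%:E.
by field; rewrite subr_eq0 gt_eqF// (lt_trans ax).
Qed.

Lemma binary_weighting : is_weighting binary_atoms.
Proof.
have [p0 p1] := andP p01; rewrite /is_weighting /= !big_cons big_nil /=.
have [ab1 ab2] := (lt_trans ax1 xb1, lt_trans ax2 xb2).
rewrite !mulr_ge0 ?invr_ge0 ?subr_ge0 ?(ltW ax1, ltW xb1, ltW ax2, ltW xb2,
  ltW p0, ltW p1, ltW ab1, ltW ab2)//=.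
by apply/eqP; field; rewrite ba1 ba2.
Qed.

Lemma binary_coupling_atomic : atomic binary_coupling binary_atoms.
Proof. exact: dirac_mix_atomic binary_weighting. Qed.

Lemma binary_target_atomic :
  atomic binary_target [seq (wa.1, wa.2.2) | wa <- binary_atoms].
Proof.
apply: dirac_mix_atomic; have := binary_weighting.
by rewrite /is_weighting big_map.
Qed.

Lemma binary_coupling_martingale :
  martingale_couplings (two_point p x1 x2) binary_target binary_coupling.
Proof.
have P1 := binary_law_atomic ax1 xb1; have P2 := binary_law_atomic ax2 xb2.
apply: (martingale_couplings_two_kernel (P := binary_law a1 x1 b1)
  (Q := binary_law a2 x2 b2)) => //.
- exact: (atomic_integrable P1).
- exact: binary_law_mean.
- exact: (atomic_integrable P2).
- exact: binary_law_mean.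
- move=> B mB; rewrite (proj2 binary_target_atomic)// (proj2 P1)// (proj2 P2)//.
  rewrite !big_cons !big_nil /= !diracE -!(EFinM, EFinD); congr _%:E; ring.
- move=> A B mA mB; rewrite (proj2 binary_coupling_atomic); last exact: measurableX.
  rewrite (proj2 P1)// (proj2 P2)// !big_cons !big_nil /= !diracE !in_setX /=.
  rewrite -!mulnb !natrM -!(EFinM, EFinD); congr _%:E; ring.
Qed.

Hypothesis uniq_ys : uniq [:: a1; b1; a2; b2].

(** The competitor [pi] sends [c], [g] from [x1] to [a2], [b2] and [e], [f] from
    [x2] to [a1], [b1]; the marginals then fix its other four masses. *)
Lemma binary_target_perturbation (pi : probability (R * R)%type R) :
  martingale_couplings (two_point p x1 x2) binary_target pi ->
  exists s c e f g, [/\ atomic pi s,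
    [/\ 0 <= c, 0 <= e, 0 <= f & 0 <= g],
    c + g = e + f, c * a2 + g * b2 = e * a1 + f * b1 &
    forall h : R * R -> R, \sum_(wa <- s) wa.1 * h wa.2 =
      \sum_(wa <- binary_atoms) wa.1 * h wa.2 +
      (c * h (x1, a2) + g * h (x1, b2) + e * h (x2, a1) + f * h (x2, b1)) -
      (e * h (x1, a1) + f * h (x1, b1) + c * h (x2, a2) + g * h (x2, b2))].
Proof.
move=> mart.
have in1 (a y : R) : (a \in [set y]) = (a == y).
  by apply/idP/eqP => [/set_mem//|->]; exact/mem_set.
have massE y : binary_target [set y] =
    (\sum_(wa <- binary_atoms) wa.1 * (wa.2.2 == y)%:R)%:E.
  rewrite (proj2 binary_target_atomic)// !big_cons !big_nil /= !diracE !in1.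
  by rewrite -!(EFinM, EFinD).
have null : binary_target (~` [set` [:: a1; b1; a2; b2]]) = 0%E.
  rewrite (proj2 binary_target_atomic).
    rewrite !big_cons !big_nil /= !diracE !memNset ?mule0 ?adde0//=;
      by rewrite !inE !eqxx ?orbT.
  by apply: measurableC; exact: measurable_seq.
have [w1 [w2 [[w1_ge0 w2_ge0] [w1E w1m] _ w12 piE]]] :=
  martingale_couplings_atomic p01 x12 uniq_ys null mart.
have := uniq_ys; rewrite /= !inE !negb_or !andbT.
move=> /andP[/and3P[a1b1 a1a2 a1b2] /andP[/andP[b1a2 b1b2] a2b2]].
have mass y : w1 y + w2 y = \sum_(wa <- binary_atoms) wa.1 * (wa.2.2 == y)%:R.
  by apply/EFin_inj; rewrite -w12 massE.
have := mass a1; have := mass b1; have := mass a2; have := mass b2.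
rewrite !big_cons !big_nil /= !eqxx.
rewrite (negbTE a1b1) (negbTE a1a2) (negbTE a1b2) (negbTE b1a2) (negbTE b1b2)
  (negbTE a2b2) !(eq_sym b1 a1) !(eq_sym a2 a1) !(eq_sym b2 a1) !(eq_sym a2 b1)
  !(eq_sym b2 b1) !(eq_sym b2 a2).
rewrite (negbTE a1b1) (negbTE a1a2) (negbTE a1b2) (negbTE b1a2) (negbTE b1b2)
  (negbTE a2b2) !mulr1 !mulr0 !addr0 !add0r => wb2 wa2 wb1 wa1.
move: w1E w1m; rewrite !big_cons !big_nil !addr0 => w1E w1m.
have mass1 : p * ((b1 - x1) / (b1 - a1)) + p * ((x1 - a1) / (b1 - a1)) = p by field.
have mean1 : p * ((b1 - x1) / (b1 - a1)) * a1 + p * ((x1 - a1) / (b1 - a1)) * b1 =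
  p * x1 by field.
exists (pair_atoms x1 w1 [:: a1; b1; a2; b2] ++
        pair_atoms x2 w2 [:: a1; b1; a2; b2]),
  (w1 a2), (w2 a1), (w2 b1), (w1 b2).
split=> //.
- lra.
- have := congr1 ( *%R^~ a1) wa1; have := congr1 ( *%R^~ b1) wb1 => /=.
  lra.
move=> h; rewrite !big_cons !big_nil /=.
rewrite -wa1 -wb1 -wa2 -wb2; ring.
Qed.

End binary.

(** * The convex order *)

Lemma atomic_finite_first_moment {R : realType} (eta : probability R R) s :
  atomic eta s -> finite_first_moment eta.
Proof. by move=> /atomic_integrable; apply. Qed.

Lemma atomic_cx_le {R : realType} (eta theta : probability R R) s t :
  atomic eta s -> atomic theta t ->
  (forall phi : R -> R, convex_function [set: R] phi ->
    \sum_(wa <- s) wa.1 * phi wa.2 <= \sum_(wa <- t) wa.1 * phi wa.2) ->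
  cx_le eta theta.
Proof.
move=> etas thetat le_st; split; [exact: atomic_finite_first_moment etas|
  exact: atomic_finite_first_moment thetat|move=> phi cphi].
have mphi := convex_measurable cphi.
by rewrite (atomic_integral etas)// (atomic_integral thetat)// lee_fin le_st.
Qed.

Lemma is_inf_cx_attained {R : realType} (S : set (probability R R)) eta :
  finite_first_moment eta -> S eta -> (forall theta, S theta -> cx_le eta theta) ->
  is_inf_cx S eta.
Proof. by move=> mom Seta lb; split=> // eta' _; exact. Qed.

Lemma is_sup_cx_attained {R : realType} (S : set (probability R R)) theta :
  finite_first_moment theta -> S theta -> (forall eta, S eta -> cx_le eta theta) ->
  is_sup_cx S theta.
Proof. by move=> mom Stheta ub; split=> // theta' _; exact. Qed.

Theorem proposition2p21 (R : realType) (p ym yp xm xp zm zp : R)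
  (p_gt0 : 0 < p) (p_lt1 : p < 1)
  (ym_yp : ym < yp) (yp_xm : yp < xm) (xm_xp : xm < xp) (xp_zm : xp < zm)
  (zm_zp : zm < zp)
  (h1 : xp - ym >= zm - xm)
  (h2 : zp - xm >= xp - yp)
  (h3 : Num.min (Num.min (Num.min (xm - ym) (xp - yp)) (zm - xm)) (zp - xp)
        >= Num.max (xm - yp) (zm - xp)) :
  let mu : probability R R := dirac_mix [:: (p, xm); (1 - p, xp)] in
  let nu_lo : probability R R := dirac_mix
    [:: (p * ((zm - xm) / (zm - ym)), ym);
        (p * ((xm - ym) / (zm - ym)), zm);
        ((1 - p) * ((zp - xp) / (zp - yp)), yp);
        ((1 - p) * ((xp - yp) / (zp - yp)), zp)] in
  let pi_up : probability (R * R)%type R := dirac_mix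
    [:: (p * ((zm - xm) / (zm - ym)), (xm, ym));
        (p * ((xm - ym) / (zm - ym)), (xm, zm));
        ((1 - p) * ((zp - xp) / (zp - yp)), (xp, yp));
        ((1 - p) * ((xp - yp) / (zp - yp)), (xp, zp))] in
  let nu_hi : probability R R := dirac_mix
    [:: (p * ((zp - xm) / (zp - yp)), yp);
        (p * ((xm - yp) / (zp - yp)), zp);
        ((1 - p) * ((zm - xp) / (zm - ym)), ym);
        ((1 - p) * ((xp - ym) / (zm - ym)), zm)] in
  let pi_down : probability (R * R)%type R := dirac_mix
    [:: (p * ((zp - xm) / (zp - yp)), (xm, yp));
        (p * ((xm - yp) / (zp - yp)), (xm, zp));
        ((1 - p) * ((zm - xp) / (zm - ym)), (xp, ym));
        ((1 - p) * ((xp - ym) / (zm - ym)), (xp, zm))] in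
  (martingale_couplings mu nu_lo pi_up /\
   is_inf_cx [set sq_image pi | pi in martingale_couplings mu nu_lo]
             (sq_image pi_up)) /\
  (martingale_couplings mu nu_hi pi_down /\
   is_sup_cx [set sq_image pi | pi in martingale_couplings mu nu_hi]
             (sq_image pi_down)).
Proof.
move=> mu nu_lo pi_up nu_hi pi_down.
have p01 : 0 < p < 1 by rewrite p_gt0.
have xx : xm != xp by rewrite lt_eqF.
have [ym_xm yp_xp xm_zm xp_zp] : [/\ ym < xm, yp < xp, xm < zm & xp < zp].
  by split; lra.
have [ym_xp xm_zp] : ym < xp /\ xm < zp by split; lra.
have [ym_zm yp_zm ym_zp yp_zp] : [/\ ym < zm, yp < zm, ym < zp & yp < zp].
  by split; lra.
have lts := (ym_yp, zm_zp, ym_zm, yp_zm, ym_zp, yp_zp).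
have uniq_lo : uniq [:: ym; zm; yp; zp].
  by rewrite /= !inE !negb_or !neq_lt !lts !orbT.
have uniq_hi : uniq [:: yp; zp; ym; zm].
  by rewrite /= !inE !negb_or !neq_lt !lts !orbT.
have up_mart : martingale_couplings mu nu_lo pi_up.
  exact: (binary_coupling_martingale p01 xx ym_xm xm_zm yp_xp xp_zp).
have down_mart : martingale_couplings mu nu_hi pi_down.
  exact: (binary_coupling_martingale p01 xx yp_xm xm_zp ym_xp xp_zm).
have up_atoms : atomic pi_up (binary_atoms p xm ym zm xp yp zp).
  exact: (binary_coupling_atomic p01 ym_xm xm_zm yp_xp xp_zp).
have down_atoms : atomic pi_down (binary_atoms p xm yp zp xp ym zm).
  exact: (binary_coupling_atomic p01 yp_xm xm_zp ym_xp xp_zm).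
split; split=> //.
- apply: is_inf_cx_attained.
  - exact: atomic_finite_first_moment (sq_image_atomic up_atoms).
  - by exists pi_up.
  move=> _ [pi /(binary_target_perturbation p01 xx ym_xm xm_zm yp_xp xp_zp uniq_lo)
    [s [c [e [f [g [pis [c0 e0 f0 g0] mass mean sumE]]]]]] <-].
  apply: (atomic_cx_le (sq_image_atomic up_atoms) (sq_image_atomic pis)).
  move=> phi cphi; rewrite !big_map; have /= -> := sumE (phi \o sq).
  have := crossing_le ym_yp yp_xm xm_xp xp_zm zm_zp h1 h2 h3 cphi c0 e0 f0 g0
    mass mean.
  lra.
- apply: is_sup_cx_attained.
  - exact: atomic_finite_first_moment (sq_image_atomic down_atoms).
  - by exists pi_down.
  move=> _ [pi /(binary_target_perturbation p01 xx yp_xm xm_zp ym_xp xp_zm uniq_hi)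
    [s [c [e [f [g [pis [c0 e0 f0 g0] mass mean sumE]]]]]] <-].
  apply: (atomic_cx_le (sq_image_atomic pis) (sq_image_atomic down_atoms)).
  move=> phi cphi; rewrite !big_map; have /= -> := sumE (phi \o sq).
  have := crossing_le ym_yp yp_xm xm_xp xp_zm zm_zp h1 h2 h3 cphi e0 c0 g0 f0
    (esym mass) (esym mean).
  lra.
Qed.
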